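(* Let $D\ge 1$ be an integer and let $Y=(Y_p)_{p\in\mathbb N}$ be a sequence of Young diagrams such that $Y_p$ has exactly $p$ cells for every $p\in\mathbb N$. Let $\Omega_Y(\mathbb R^D)$ be the associated graded space of tensor fields and $d=\mathbf Y\circ\partial$ the associated degree-one operator on it, as defined in the context. Let $N$ be an integer with $N\ge 2$ and assume that the number of columns of $Y_p$ is strictly smaller than $N$ (i.e. $\le N-1$) for every $p\in\mathbb N$. Then $d^N=0$ on $\Omega_Y(\mathbb R^D)$.
   Context: **Young symmetrizers.** For each $p$, fix a numbering of the cells of $Y_p$ by $1,\dots,p$. The Young symmetrizer $\mathbf Y_p$ acts on covariant tensors of degree $p$ on $\mathbb R^D$. It is the projection $\mathbf Y_p=c_p\,\mathbf A\circ\mathbf S$, where $\mathbf S$ symmetrizes over the indices in each row of $Y_p$, $\mathbf A$ then antisymmetrizes over the indices in each column, and $c_p\ne0$ is the normalization constant making $\mathbf Y_p^2=\mathbf Y_p$. A tensor of degree $p$ has Young symmetry type $Y_p$ if it lies in the image of $\mathbf Y_p$. For $p=0$ tensors are scalars and $\mathbf Y_0$ is the identity. **Tensor fields.** $\Omega^p_Y(\mathbb R^D)$ is the real vector space of smooth ($C^\infty$) covariant tensor fields of degree $p$ on $\mathbb R^D$ with values in the tensors of Young symmetry type $Y_p$. Set $\Omega_Y(\mathbb R^D)=\bigoplus_{p\ge 0}\Omega^p_Y(\mathbb R^D)$. **The operator $d$.** For a covariant tensor field $T$ of degree $p$ with components $T_{\mu_1\dots\mu_p}(x)$, $\partial T$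 denotes the covariant tensor field of degree $p+1$ with components $\partial_{\mu_1}T_{\mu_2\dots\mu_{p+1}}(x)$, where $\partial_\mu=\partial/\partial x^\mu$ in the canonical coordinates of $\mathbb R^D$. The operator $d$ is defined by $$d=\mathbf Y_{p+1}\circ\partial:\Omega^p_Y(\mathbb R^D)\to\Omega^{p+1}_Y(\mathbb R^D),\qquad p\in\mathbb N.$$ *)

(* Defs.v *)
(* MathComp / MathComp-Analysis world; R stands for any realType. *)
From mathcomp Require Import all_boot all_order all_algebra all_fingroup.
From mathcomp Require Import all_classical all_reals all_analysis.

Set Implicit Arguments.
Unset Strict Implicit.
Unset Printing Implicit Defensive.

Import Order.TTheory GRing.Theory Num.Theory.
Import numFieldNormedType.Exports.

Local Open Scope ring_scope.

(* A diagram with p cells, given by its weakly decreasing positive row lengths;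
   rows and columns are counted from 0. *)
Record young_diagram (p : nat) := YoungDiagram {
  row_lengths :> seq nat;
  row_lengths_sorted : sorted geq row_lengths;
  row_lengths_gt0 : all (fun l => 0 < l)%N row_lengths;
  row_lengths_sum : sumn row_lengths = p }.

Definition in_diagram p (Y : young_diagram p) (c : nat * nat) : bool :=
  (c.2 < nth 0%N Y c.1)%N.

(* The first row is the longest one. *)
Definition ncols p (Y : young_diagram p) : nat := head 0%N Y.

(* The label k + 1 of the cell [cell_of k] is represented by k : 'I_p. *)
Record numbering p (Y : young_diagram p) := Numbering {
  cell_of :> 'I_p -> nat * nat;
  cell_of_inj : injective cell_of;
  cell_of_surj : forall c, (exists k, cell_of k = c) <-> in_diagram Y c }.

Definition row_perms p (Y : young_diagram p) (num : numbering Y) : {set 'S_p} :=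
  [set s : 'S_p | [forall k, (num (s k)).1 == (num k).1]].

Definition col_perms p (Y : young_diagram p) (num : numbering Y) : {set 'S_p} :=
  [set s : 'S_p | [forall k, (num (s k)).2 == (num k).2]].

(* Multi-indices mu_1 ... mu_p; slot k + 1 is represented by k : 'I_p. *)
Notation multi_index D p := {ffun 'I_p -> 'I_D}.

(* Arrays of components; [R^o] makes the type a vector space over R. *)
Notation tensor R D p := {ffun multi_index D p -> R^o}.

Section YoungSymmetrizer.
Variables (R : realType) (D p : nat).
Implicit Types (T : tensor R D p) (Y : young_diagram p).

Definition permute (s : 'S_p) T : tensor R D p :=
  [ffun mu : multi_index D p => T [ffun k => mu (s k)]].

(* S and A are taken without the factors 1/|group|; these are absorbed in the
   constant c below. *)
Definition row_symmetrize Y (num : numbering Y) T : tensor R D p :=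
  \sum_(s in row_perms num) permute s T.

Definition col_antisymmetrize Y (num : numbering Y) T : tensor R D p :=
  \sum_(s in col_perms num) (-1) ^+ odd_perm s *: permute s T.

Definition young_symmetrizer Y (num : numbering Y) (c : R) T : tensor R D p :=
  c *: col_antisymmetrize num (row_symmetrize num T).

End YoungSymmetrizer.

(* If the diagram has more than D rows then A o S = 0 on tensors on R^D, and
   every c != 0 qualifies; otherwise c is unique. *)
Definition young_normalization (R : realType) (D p : nat)
    (Y : young_diagram p) (num : numbering Y) (c : R) : Prop :=
  c != 0 /\ forall T : tensor R D p,
    young_symmetrizer num c (young_symmetrizer num c T)
    = young_symmetrizer num c T.

Definition has_young_type (R : realType) (D p : nat)
    (Y : young_diagram p) (num : numbering Y) (c : R)
    (T : tensor R D p) : Prop :=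
  exists T' : tensor R D p, T = young_symmetrizer num c T'.

Definition partial (R : realType) (D : nat) (i : 'I_D)
    (f : 'rV[R]_D -> R) : 'rV[R]_D -> R :=
  fun x => 'D_(delta_mx 0 i) f x.

Definition iter_partial (R : realType) (D : nat) (s : seq 'I_D)
    (f : 'rV[R]_D -> R) : 'rV[R]_D -> R :=
  foldr (@partial R D) f s.

(* The partial derivatives of all orders exist and are continuous. *)
Definition smooth (R : realType) (D : nat) (f : 'rV[R]_D -> R) : Prop :=
  forall s : seq 'I_D, continuous (iter_partial s f) /\
    forall (i : 'I_D) x, derivable (iter_partial s f) x (delta_mx 0 i).

Definition tensor_field (R : realType) (D p : nat) : Type :=
  'rV[R]_D -> tensor R D p.

Definition is_Omega (R : realType) (D p : nat)
    (Y : young_diagram p) (num : numbering Y) (c : R)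
    (T : tensor_field R D p) : Prop :=
  (forall mu, smooth (fun x => T x mu)) /\
  (forall x, has_young_type num c (T x)).

Definition partial_field (R : realType) (D p : nat)
    (T : tensor_field R D p) : tensor_field R D p.+1 :=
  fun x => [ffun mu : multi_index D p.+1 =>
    partial (mu ord0) (fun y => T y [ffun k => mu (lift ord0 k)]) x].

Definition graded_field (R : realType) (D : nat) : Type :=
  forall p, tensor_field R D p.

Section Graded.
Variables (R : realType) (D : nat) (Y : forall p, young_diagram p).
Variables (num : forall p, numbering (Y p)) (c : nat -> R).

(* Elements of the direct sum: finitely supported families. *)
Definition Omega_Y (T : graded_field R D) : Prop :=
  (forall p, is_Omega (num p) (c p) (T p)) /\
  (exists n, forall p, (n <= p)%N -> forall x, T p x = 0).

Definition d_homogeneous p (T : tensor_field R D p) : tensor_field R D p.+1 :=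
  fun x => young_symmetrizer (num p.+1) (c p.+1) (partial_field T x).

Definition d (T : graded_field R D) : graded_field R D := fun p =>
  match p return tensor_field R D p with
  | 0 => fun=> 0
  | q.+1 => d_homogeneous (T q)
  end.

End Graded.

Lemma young_symmetrizer0 (R : realType) (D : nat) (Y : young_diagram 0)
    (num : numbering Y) (c : R) (T : tensor R D 0) :
  young_normalization D num c -> young_symmetrizer num c T = T.
Proof.
have E (U : tensor R D 0) : young_symmetrizer num c U = c *: U.
  have r1 : row_perms num = [set 1%g].
    by apply/setP => s; rewrite !inE permS0 eqxx; apply/forallP => -[].
  have c1 : col_perms num = [set 1%g].
    by apply/setP => s; rewrite !inE permS0 eqxx; apply/forallP => -[].
  have p1 (V : tensor R D 0) : permute 1%g V = V.
    by apply/ffunP => mu; rewrite ffunE; congr (V _); apply/ffunP => -[].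
  rewrite /young_symmetrizer /col_antisymmetrize /row_symmetrize r1 c1.
  by rewrite !big_set1 !p1 odd_perm1 expr0 scale1r.
case=> c0 idem; have := idem T; rewrite !E.
by move/(scalerI c0).
Qed.

Section Closure.
Variables (R : realType) (D : nat).
Implicit Types (f g : 'rV[R]_D -> R).

Lemma smooth_partial i f : smooth f -> smooth (partial i f).
Proof. by move=> sf s; have := sf (rcons s i); rewrite /iter_partial foldr_rcons. Qed.

Lemma iter_partial0 (s : seq 'I_D) :
  iter_partial s (fun=> 0 : R) = (fun=> 0).
Proof.
elim: s => //= i s ->; apply/funext => x.
exact: (derive_cst (0 : R)).
Qed.

Lemma smooth0 : smooth (fun _ : 'rV[R]_D => 0 : R).
Proof.
move=> s; rewrite iter_partial0; split; first exact: cst_continuous.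
by move=> i x; exact: derivable_cst.
Qed.

Lemma iter_partialD s f g : smooth f -> smooth g ->
  iter_partial s (f + g) = iter_partial s f + iter_partial s g.
Proof.
move=> sf sg; elim: s => //= i s ->; apply/funext => x.
rewrite /partial deriveD //; [exact: (sf s).2|exact: (sg s).2].
Qed.

Lemma smoothD f g : smooth f -> smooth g -> smooth (f + g).
Proof.
move=> sf sg s; rewrite iter_partialD //; split.
  move=> x; have h1 := (sf s).1 x; have h2 := (sg s).1 x; exact: (cvgD h1 h2).
by move=> i x; apply: derivableD; [exact: (sf s).2|exact: (sg s).2].
Qed.

Lemma iter_partialZ s (k : R) f : smooth f ->
  iter_partial s (k \*: f) = k \*: iter_partial s f.
Proof.
move=> sf; elim: s => //= i s ->; apply/funext => x.
by rewrite /partial deriveZ //; exact: (sf s).2.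
Qed.

Lemma smoothZ (k : R) f : smooth f -> smooth (k \*: f).
Proof.
move=> sf s; rewrite iter_partialZ //; split.
  move=> x; have h := (sf s).1 x; exact: (cvgM (cvg_cst k) h).
by move=> i x; apply: derivableZ; exact: (sf s).2.
Qed.

Lemma smooth_sum (I : Type) (r : seq I) (P : pred I) (F : I -> 'rV[R]_D -> R) :
  (forall i, smooth (F i)) -> smooth (fun x => \sum_(i <- r | P i) F i x).
Proof.
move=> sF; elim: r => [|i r IH].
  by under eq_fun do rewrite big_nil; exact: smooth0.
under eq_fun do rewrite big_cons.
by case: (P i) => //; exact: smoothD.
Qed.

Lemma smooth_young p (Y : young_diagram p) (num : numbering Y) (c : R)
    (F : tensor_field R D p) :
  (forall mu, smooth (fun x => F x mu)) ->
  forall mu, smooth (fun x => young_symmetrizer num c (F x) mu).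
Proof.
move=> sF mu; rewrite /young_symmetrizer.
under eq_fun do rewrite ffunE /col_antisymmetrize sum_ffunE.
apply: smoothZ; apply: smooth_sum => s.
under eq_fun do rewrite ffunE.
apply: smoothZ; under eq_fun do rewrite ffunE /row_symmetrize sum_ffunE.
by apply: smooth_sum => t; under eq_fun do rewrite ffunE; exact: sF.
Qed.

Lemma young_symmetrizer_zero p (Y : young_diagram p) (num : numbering Y)
    (c : R) : young_symmetrizer num c (0 : tensor R D p) = 0.
Proof.
have p0 s : permute s (0 : tensor R D p) = 0.
  by apply/ffunP => mu; rewrite !ffunE.
rewrite /young_symmetrizer /col_antisymmetrize /row_symmetrize.
rewrite [X in c *: X]big1 ?scaler0 // => s _.
by rewrite [X in permute _ X]big1 // p0 scaler0.
Qed.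

End Closure.

Lemma d_Omega_Y (R : realType) (D : nat) (Y : forall p, young_diagram p)
    (num : forall p, numbering (Y p)) (c : nat -> R) (T : graded_field R D) :
  Omega_Y num c T -> Omega_Y num c (d num c T).
Proof.
case=> OT [n T0]; split=> [[|p]|].
- split=> [mu|x].
    by under eq_fun do rewrite ffunE; exact: smooth0.
  by exists 0; rewrite young_symmetrizer_zero.
- split=> [|x]; last by exists (partial_field (T p) x).
  apply: smooth_young => mu; under eq_fun do rewrite ffunE.
  by apply: smooth_partial; exact: (OT p).1.
- exists n.+1 => -[//|p] np x /=; rewrite /d_homogeneous.
  suff -> : partial_field (T p) x = 0 by exact: young_symmetrizer_zero.
  apply/ffunP => mu; rewrite !ffunE /partial.
  under eq_fun do rewrite T0 // ffunE.
  exact: (derive_cst (0 : R)).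
Qed.

(* Main.v *)
(* Pointwise linear operations and permutations of the slots commute with the
   derivatives, so d^N T is, up to the last column antisymmetrization, a linear
   combination of fields d_{mu_1} ... d_{mu_N} g in which N of the slots are
   occupied by derivatives.  The diagram has fewer than N columns, so two of
   these slots lie in the same column; partial derivatives commute, so the
   antisymmetrization over that column gives 0. *)
Require Import Defs.
From mathcomp Require Import all_boot all_order all_algebra all_fingroup.
From mathcomp Require Import all_classical all_reals all_analysis.
From mathcomp Require Import ring lra.

Set Implicit Arguments.
Unset Strict Implicit.
Unset Printing Implicit Defensive.
Import Order.TTheory GRing.Theory Num.Theory.
Import numFieldNormedType.Exports.

Local Open Scope ring_scope.

(** * Equality of mixed directional derivatives *)

Section Schwarz.
Variables (R : realType) (V : normedModType R).
Implicit Types (f : V -> R) (x v w : V).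

Lemma is_derive_shift f x v a : derivable f (x + a) v ->
  is_derive x v (fun z => f (z + a)) ('D_v f (x + a)).
Proof.
move=> df.
have E : (fun h : R => h^-1 *: (((fun z => f (z + a)) \o shift x) (h *: v) - f (x + a)))
   = (fun h => h^-1 *: ((f \o shift (x + a)) (h *: v) - f (x + a))).
  by apply/funext => h /=; rewrite addrA.
by split; rewrite /derivable /derive E.
Qed.

(** At [s] the restriction of [f] to the line has the same difference quotients as [f] at
    [x + s *: v], so one-variable calculus applies along lines. *)
Lemma is_derive_line f x v (s : R) : derivable f (x + s *: v) v ->
  is_derive s (1 : R) (fun r : R => f (x + r *: v)) ('D_v f (x + s *: v)).
Proof.
move=> df.
have E : (fun h : R => h^-1 *: (((fun r : R => f (x + r *: v)) \o shift s) (h *: 1)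
      - f (x + s *: v)))
   = (fun h => h^-1 *: ((f \o shift (x + s *: v)) (h *: v) - f (x + s *: v))).
  apply/funext => h /=; congr (_ *: (f _ - _)).
  by rewrite scalerDl [h *: 1]mulr1 addrCA.
by split; rewrite /derivable /derive E.
Qed.

Lemma MVT_line f x v (h : R) : 0 < h -> (forall y, derivable f y v) ->
  exists2 s, 0 < s < h & f (x + h *: v) - f x = h * 'D_v f (x + s *: v).
Proof.
move=> h0 df.
have dl (s : R) : is_derive s (1 : R) (fun r : R => f (x + r *: v)) ('D_v f (x + s *: v)).
  exact/is_derive_line/df.
have [|s] := @MVT R (fun r : R => f (x + r *: v)) (fun s => 'D_v f (x + s *: v)) 0 h h0.
- by apply: derivable_within_continuous => s _; case: (dl s).
by rewrite in_itv /= => s0h; rewrite scale0r addr0 subr0 mulrC; exists s.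
Qed.

(** Two mean value arguments: along [v] for the increment of [f] by [h *: w], then along [w] for
    ['D_v f]. *)
Lemma second_difference f x v w (h : R) : 0 < h ->
  (forall y, derivable f y v) -> (forall y, derivable ('D_v f) y w) ->
  exists s t, [/\ 0 < s < h, 0 < t < h &
    f (x + h *: v + h *: w) - f (x + h *: v) - f (x + h *: w) + f x
    = h ^+ 2 * 'D_w ('D_v f) (x + s *: v + t *: w)].
Proof.
move=> h0 df ddf.
pose u := (fun y => f (y + h *: w)) - f.
have du y : is_derive y v u ('D_v f (y + h *: w) - 'D_v f y).
  by apply: is_deriveB; [exact/is_derive_shift | exact/derivableP].
have [|s sh E] := MVT_line x h0 (f := u) (v := v).
  by move=> y; case: (du y).
have [t th E'] := MVT_line (x + s *: v) h0 ddf.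
exists s, t; split=> //; rewrite expr2 -mulrA -E'.
have -> : 'D_v f (x + s *: v + h *: w) - 'D_v f (x + s *: v) = 'D_v u (x + s *: v).
  by case: (du (x + s *: v)).
rewrite -E /u !fctE; ring.
Qed.

(** The second difference is symmetric in [v] and [w], so the two mixed derivatives agree at
    suitable points arbitrarily close to [x]; continuity carries the equality to [x]. *)
Lemma schwarz f x v w :
  (forall y, derivable f y v) -> (forall y, derivable f y w) ->
  (forall y, derivable ('D_v f) y w) -> (forall y, derivable ('D_w f) y v) ->
  {for x, continuous ('D_w ('D_v f))} -> {for x, continuous ('D_v ('D_w f))} ->
  'D_w ('D_v f) x = 'D_v ('D_w f) x.
Proof.
move=> dv dw dvw dwv cvw cwv.
apply/eqP; rewrite -subr_eq0 -normr_le0; apply/ler_addgt0Pl => e e0.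
have e20 : 0 < e / 2 by lra.
have [/= r1 r10 H1] : exists2 r, 0 < r & forall y, `|x - y| < r ->
    `|'D_w ('D_v f) x - 'D_w ('D_v f) y| < e / 2.
  move/cvgrPdist_lt : cvw => /(_ _ e20) /nbhs_ballP [r r0 rP].
  by exists r => // y; rewrite -ball_normE in rP; exact: rP.
have [/= r2 r20 H2] : exists2 r, 0 < r & forall y, `|x - y| < r ->
    `|'D_v ('D_w f) x - 'D_v ('D_w f) y| < e / 2.
  move/cvgrPdist_lt : cwv => /(_ _ e20) /nbhs_ballP [r r0 rP].
  by exists r => // y; rewrite -ball_normE in rP; exact: rP.
(* Steps shorter than [r / M] along [v] and [w] stay within [r] of [x]; the summand 1 keeps [M]
   positive when both vectors vanish. *)
pose r := Num.min r1 r2; pose M := `|v| + `|w| + 1.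
have r0 : 0 < r by rewrite lt_min r10 r20.
have M0 : 0 < M by rewrite ltr_wpDl // addr_ge0.
have h0 : 0 < r / M by exact: divr_gt0.
have small (a b : V) s t : `|a| + `|b| + 1 = M -> 0 < s < r / M -> 0 < t < r / M ->
    `|x - (x + s *: a + t *: b)| < r.
  move=> EM /andP[s0 sh] /andP[t0 th].
  rewrite -addrA opprD addrA subrr add0r normrN.
  rewrite (le_lt_trans (ler_normD _ _))// !normrZ !gtr0_norm //.
  have -> : r = r / M * M by rewrite divfK // gt_eqF.
  rewrite -{2}EM; apply: (@le_lt_trans _ _ (r / M * (`|a| + `|b|)));
    last by rewrite ltr_pM2l //; lra.
  by rewrite mulrDr; apply: lerD; apply: ler_wpM2r => //; exact: ltW.
have [s [t [sh th E]]] := second_difference x h0 dv dvw.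
have [s' [t' [sh' th' E']]] := second_difference x h0 dw dwv.
(* Both sides times [(r / M) ^+ 2] are the same second difference, up to the order of its terms. *)
have EE : 'D_w ('D_v f) (x + s *: v + t *: w) = 'D_v ('D_w f) (x + s' *: w + t' *: v).
  have h2 : (r / M) ^+ 2 != 0 by rewrite expf_neq0 // gt_eqF.
  rewrite [x + _ *: w + _]addrAC in E'.
  apply: (mulfI h2); apply: etrans (esym E) (etrans _ E').
  by congr (_ + _); exact: addrAC.
have := H1 _ (lt_le_trans (small _ _ _ _ erefl sh th) _); rewrite ge_min lexx => /(_ isT).
have := H2 _ (lt_le_trans (small w v _ _ _ sh' th') _).
rewrite /M [`|v| + _]addrC ge_min lexx orbT => /(_ erefl isT).
by rewrite EE addr0 => B A; exact/ltW/(distm_lt_splitl A B).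
Qed.

End Schwarz.

(** * Reordering iterated partial derivatives *)

Lemma partialC (R : realType) (D : nat) (i j : 'I_D) (f : 'rV[R]_D -> R) :
  smooth f -> partial i (partial j f) = partial j (partial i f).
Proof.
move=> sf; apply/funext => x; apply: schwarz => [y|y|y|y||].
- exact: (sf [::]).2.
- exact: (sf [::]).2.
- exact: (sf [:: j]).2.
- exact: (sf [:: i]).2.
- exact: (sf [:: i; j]).1.
- exact: (sf [:: j; i]).1.
Qed.

Lemma smooth_iter_partial (R : realType) (D : nat) (s : seq 'I_D)
    (f : 'rV[R]_D -> R) : smooth f -> smooth (iter_partial s f).
Proof. by elim: s => //= i s IH /IH; exact: smooth_partial. Qed.

(** Commuting adjacent derivatives brings any entry of a list to its front; induction on [s] then
    strips the head of [s] from both lists. *)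
Lemma iter_partial_perm (R : realType) (D : nat) (s t : seq 'I_D)
    (f : 'rV[R]_D -> R) :
  smooth f -> perm_eq s t -> iter_partial s f = iter_partial t f.
Proof.
move=> sf; have rem_cons i (u : seq 'I_D) : i \in u ->
    iter_partial u f = partial i (iter_partial (rem i u) f).
  elim: u => //= j u IH; rewrite inE eq_sym; case: eqVneq => [->//|_] /= /IH ->.
  by rewrite partialC //; exact: smooth_iter_partial.
elim: s t => [|i s IH] t; first by move/perm_size/esym/size0nil => ->.
move=> st; have it : i \in t by rewrite -(perm_mem st) mem_head.
rewrite (rem_cons _ _ it) /= (IH (rem i t)) // -(perm_cons i).
by apply: perm_trans st _; exact: perm_to_rem.
Qed.

(** * Column antisymmetrization and columns of the diagram *)

Section Symmetrizers.
Variables (R : realType) (D p : nat) (Y : young_diagram p) (num : numbering Y).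

(** The factors swap because the product of permutations applies its left factor first: [t * s]
    sends [k] to [s (t k)]. *)
Lemma permuteM (s t : 'S_p) (T : tensor R D p) :
  permute s (permute t T) = permute (t * s)%g T.
Proof.
apply/ffunP => mu; rewrite !ffunE; congr (T _).
by apply/ffunP => k; rewrite !ffunE permM.
Qed.

Lemma col_antisymmetrizeD (T U : tensor R D p) :
  col_antisymmetrize num (T + U) =
  col_antisymmetrize num T + col_antisymmetrize num U.
Proof.
rewrite /col_antisymmetrize -big_split /=; apply: eq_bigr => s _.
by rewrite -scalerDr; congr (_ *: _); apply/ffunP => mu; rewrite !ffunE.
Qed.

Lemma col_antisymmetrizeZ (a : R) (T : tensor R D p) :
  col_antisymmetrize num (a *: T) = a *: col_antisymmetrize num T.
Proof.
rewrite /col_antisymmetrize scaler_sumr; apply: eq_bigr => s _.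
by rewrite scalerA mulrC -scalerA; congr (_ *: _); apply/ffunP => mu; rewrite !ffunE.
Qed.

(** Reindexing the sum by [s] to [t * s], with [t] the transposition, flips every sign and leaves
    every permuted tensor unchanged, so the sum is its own opposite. *)
Lemma col_antisymmetrize_tperm (a b : 'I_p) (T : tensor R D p) :
  a != b -> (num a).2 = (num b).2 -> permute (tperm a b) T = T ->
  col_antisymmetrize num T = 0.
Proof.
move=> ab numab sT; set t := tperm a b.
have t2 k : (num (t k)).2 = (num k).2 by rewrite /t; case: tpermP => // ->.
have memt s : ((t * s)%g \in col_perms num) = (s \in col_perms num).
  rewrite !inE; apply/forallP/forallP => H k; have := H (t k); rewrite permM.
    by rewrite /t tpermK -/t t2.
  by rewrite t2.
have E : col_antisymmetrize num T = - col_antisymmetrize num T.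
  rewrite {2}/col_antisymmetrize (reindex_inj (mulgI t)) -sumrN.
  apply: eq_big => [s|s _]; first by rewrite memt.
  rewrite odd_permM odd_tperm ab signr_addb expr1 mulN1r scaleNr opprK.
  by rewrite -permuteM sT.
apply/ffunP => mu; move/ffunP: E => /(_ mu); rewrite !ffunE; lra.
Qed.

Lemma numbering_col_lt_ncols (k : 'I_p) : ((num k).2 < ncols Y)%N.
Proof.
have /(cell_of_surj num) : exists i, num i = num k by exists k.
rewrite /in_diagram => /leq_trans; apply; rewrite /ncols.
have := row_lengths_sorted Y; case: (row_lengths Y) => [|l s] /=;
  first by rewrite nth_nil.
(* Rows past the last one get the default length 0, which also satisfies the bound. *)
move=> ls; case: (num k).1 => //= i; case: (ltnP i (size s)) => [si|si];
  last by rewrite nth_default.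
have geq_trans : transitive geq by move=> y x z /= xy yz; exact: leq_trans yz xy.
by have /allP := order_path_min geq_trans ls; apply; exact: mem_nth.
Qed.

(** Pigeonhole: otherwise the column indices of [l] would be too many distinct numbers below
    [ncols Y]. *)
Lemma same_column (l : seq 'I_p) : uniq l -> (ncols Y < size l)%N ->
  exists a b, [/\ a \in l, b \in l, a != b & (num a).2 = (num b).2].
Proof.
move=> ul lY; apply: contrapT => H.
suff : (size [seq (num k).2 | k <- l] <= size (iota 0 (ncols Y)))%N.
  by rewrite size_map size_iota leqNgt lY.
apply: uniq_leq_size => [|j /mapP[k _ ->]]; last first.
  by rewrite mem_iota /= numbering_col_lt_ncols.
rewrite map_inj_in_uniq // => a b al bl E; apply/eqP; apply: contra_notT H => ab.
by exists a, b.
Qed.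

End Symmetrizers.

(** * Fields carrying a given number of derivatives *)

(* The tensor fields [d_{mu l_1} ... d_{mu l_j} g_mu], where the component
   [g_mu] does not depend on the slots of [mu] listed in [l]. *)
Definition pure_derivative (R : realType) (D j p : nat)
    (W : tensor_field R D p) : Prop :=
  exists (l : seq 'I_p) (g : multi_index D p -> 'rV[R]_D -> R),
  [/\ uniq l, size l = j, forall mu, smooth (g mu),
      forall mu nu : multi_index D p,
        (forall k, k \notin l -> mu k = nu k) -> g mu = g nu
    & forall x mu, W x mu = iter_partial [seq mu k | k <- l] (g mu) x].

(** The linear span of the pure fields, given inductively so that its closure under linear
    operations reduces to pure fields. *)
Inductive derivative_span (R : realType) (D j p : nat) :
    tensor_field R D p -> Prop :=
| derivative_span_pure W : pure_derivative j W -> derivative_span j W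
| derivative_span0 : derivative_span j (fun=> 0)
| derivative_spanD U W : derivative_span j U -> derivative_span j W ->
    derivative_span j (fun x => U x + W x)
| derivative_spanZ (a : R) W : derivative_span j W ->
    derivative_span j (fun x => a *: W x).

Section DerivativeSpan.
Variables (R : realType) (D : nat).

(** The derivative that read slot [k] now reads slot [s k], so the list of slots becomes its image
    under [s]. *)
Lemma pure_derivative_permute j p (s : 'S_p) (W : tensor_field R D p) :
  pure_derivative j W -> pure_derivative j (fun x => permute s (W x)).
Proof.
move=> [l [g [ul sl sg indep WE]]].
exists (map s l), (fun mu => g [ffun k => mu (s k)]); split.
- by rewrite map_inj_uniq //; exact: perm_inj.
- by rewrite size_map.
- by move=> mu; exact: sg.
- move=> mu nu H; apply: indep => k kl; rewrite !ffunE; apply: H.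
  by rewrite mem_map //; exact: perm_inj.
- move=> x mu; rewrite ffunE WE -map_comp; congr (iter_partial _ _ _).
  by apply: eq_map => k; rewrite ffunE.
Qed.

(** The new derivative occupies slot [ord0], and the old slots move up by [lift ord0]. *)
Lemma pure_derivative_partial j p (W : tensor_field R D p) :
  pure_derivative j W -> pure_derivative j.+1 (partial_field W).
Proof.
move=> [l [g [ul sl sg indep WE]]].
exists (ord0 :: map (lift ord0) l), (fun mu => g [ffun k => mu (lift ord0 k)]); split.
- rewrite /= map_inj_uniq ?ul ?andbT; last exact: lift_inj.
  by apply/mapP => -[k _ /eqP]; rewrite (negPf (neq_lift _ _)).
- by rewrite /= size_map sl.
- by move=> mu; exact: sg.
- move=> mu nu H; apply: indep => k kl; rewrite !ffunE; apply: H.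
  by rewrite inE eq_sym (negPf (neq_lift _ _)) mem_map //; exact: lift_inj.
- move=> x mu; rewrite ffunE /= -map_comp; congr (partial _ _ x).
  apply/funext => y; rewrite WE; congr (iter_partial _ _ _).
  by apply: eq_map => k; rewrite ffunE.
Qed.

(** Supplies the derivability under which differentiation is linear on the span. *)
Lemma derivative_span_smooth j p (W : tensor_field R D p) :
  derivative_span j W -> forall mu, smooth (fun x => W x mu).
Proof.
elim=> {W} [W [l [g [_ _ sg _ WE]]]||U W _ IU _ IW|a W _ IW] mu.
- by under eq_fun do rewrite WE; exact: smooth_iter_partial.
- by under eq_fun do rewrite ffunE; exact: smooth0.
- by under eq_fun do rewrite ffunE; exact: smoothD.
- by under eq_fun do rewrite ffunE; exact: smoothZ.
Qed.

Lemma derivative_span_permute j p (s : 'S_p) (W : tensor_field R D p) :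
  derivative_span j W -> derivative_span j (fun x => permute s (W x)).
Proof.
elim=> {W} [W pW||U W _ IU _ IW|a W _ IW].
- exact/derivative_span_pure/pure_derivative_permute.
- rewrite (_ : (fun=> _) = (fun=> 0)); first exact: derivative_span0.
  by apply/funext => x; apply/ffunP => mu; rewrite !ffunE.
- rewrite (_ : (fun=> _) = (fun x => permute s (U x) + permute s (W x))).
    exact: derivative_spanD.
  by apply/funext => x; apply/ffunP => mu; rewrite !ffunE.
- rewrite (_ : (fun=> _) = (fun x => a *: permute s (W x))).
    exact: derivative_spanZ.
  by apply/funext => x; apply/ffunP => mu; rewrite !ffunE.
Qed.

Lemma derivative_span_sum j p (I : Type) (r : seq I) (P : pred I)
    (F : I -> tensor_field R D p) :
  (forall i, derivative_span j (F i)) ->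
  derivative_span j (fun x => \sum_(i <- r | P i) F i x).
Proof.
move=> jF; elim: r => [|i r IH].
  by under eq_fun do rewrite big_nil; exact: derivative_span0.
under eq_fun do rewrite big_cons.
by case: (P i) => //; exact: derivative_spanD.
Qed.

Lemma derivative_span_row_symmetrize j p (Y : young_diagram p)
    (num : numbering Y) (W : tensor_field R D p) :
  derivative_span j W -> derivative_span j (fun x => row_symmetrize num (W x)).
Proof. by move=> jW; apply: derivative_span_sum => s; exact: derivative_span_permute. Qed.

Lemma derivative_span_young j p (Y : young_diagram p) (num : numbering Y)
    (c : R) (W : tensor_field R D p) :
  derivative_span j W ->
  derivative_span j (fun x => young_symmetrizer num c (W x)).
Proof.
move=> jW; apply: derivative_spanZ; apply: derivative_span_sum => s.
apply: derivative_spanZ; apply: derivative_span_permute.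
exact: derivative_span_row_symmetrize.
Qed.

Lemma derivative_span_partial j p (W : tensor_field R D p) :
  derivative_span j W -> derivative_span j.+1 (partial_field W).
Proof.
elim=> {W} [W pW||U W jU IU jW IW|a W jW IW].
- exact/derivative_span_pure/pure_derivative_partial.
- rewrite (_ : partial_field _ = (fun=> 0)); first exact: derivative_span0.
  apply/funext => x; apply/ffunP => mu; rewrite !ffunE /partial.
  exact: (derive_cst (0 : R)).
- rewrite (_ : partial_field _ = (fun x => partial_field U x + partial_field W x)).
    exact: derivative_spanD.
  apply/funext => x; apply/ffunP => mu; rewrite !ffunE /partial.
  under eq_fun do rewrite ffunE.
  by apply: deriveD; [exact: (derivative_span_smooth jU _ [::]).2
    | exact: (derivative_span_smooth jW _ [::]).2].
- rewrite (_ : partial_field _ = (fun x => a *: partial_field W x)).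
    exact: derivative_spanZ.
  apply/funext => x; apply/ffunP => mu; rewrite !ffunE /partial.
  under eq_fun do rewrite ffunE.
  by apply: deriveZ; exact: (derivative_span_smooth jW _ [::]).2.
Qed.

(** Exchanging two derivative slots only reorders commuting partial derivatives, and the coefficient
    function ignores both slots. *)
Lemma pure_derivative_tperm j p (W : tensor_field R D p) :
  pure_derivative j W -> exists l : seq 'I_p, [/\ uniq l, size l = j &
    {in l &, forall a b x, permute (tperm a b) (W x) = W x}].
Proof.
move=> [l [g [ul sl sg indep WE]]]; exists l; split=> // a b al bl x.
have tl k : (tperm a b k \in l) = (k \in l).
  by case: tpermP => [->|->|]; rewrite ?al ?bl.
apply/ffunP => mu; rewrite ffunE !WE.
rewrite (indep [ffun k => mu (tperm a b k)] mu) => [|k kl]; last first.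
  by rewrite ffunE tpermD //; apply: contraNneq kl => <-.
rewrite (iter_partial_perm (t := [seq mu k | k <- l])) //.
(* The exchange maps [l] to a rearrangement of itself, as [a] and [b] both lie in it. *)
rewrite (_ : map _ l = map mu (map (tperm a b) l)); last first.
  by rewrite -map_comp; apply: eq_map => k; rewrite ffunE.
apply: perm_map; apply: uniq_perm => // [|k].
  by rewrite map_inj_uniq //; exact: perm_inj.
by rewrite -{1}[k](tpermK a b) mem_map ?tl //; exact: perm_inj.
Qed.

(** A pure field has two derivative slots in one column and is symmetric in them; linearity covers
    the rest of the span. *)
Lemma col_antisymmetrize_derivative_span j p (Y : young_diagram p)
    (num : numbering Y) (W : tensor_field R D p) (x : 'rV[R]_D) :
  (ncols Y < j)%N -> derivative_span j W ->
  col_antisymmetrize num (W x) = 0.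
Proof.
move=> Yj; elim=> {W} [W /pure_derivative_tperm[l [ul sl symW]]||U W _ IU _ IW|a W _ IW].
- have [|a [b [al bl ab numab]]] := same_column num ul; first by rewrite sl.
  by apply: col_antisymmetrize_tperm ab numab _; exact: symW.
- by have := col_antisymmetrizeZ num 0 (0 : tensor R D p); rewrite !scale0r.
- by rewrite col_antisymmetrizeD IU IW addr0.
- by rewrite col_antisymmetrizeZ IW scaler0.
Qed.

(** Each [d] contributes one derivative, and the Young symmetrizer preserves the span. *)
Lemma derivative_span_iter_d (Y : forall p, young_diagram p)
    (num : forall p, numbering (Y p)) (c : nat -> R) (T : graded_field R D) :
  Omega_Y num c T -> forall n p, derivative_span n (iter n (d num c) T p).
Proof.
move=> [OT _]; elim=> [|n IH] [|p] /=; last first.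
- exact/derivative_span_young/derivative_span_partial/IH.
- exact: derivative_span0.
(* For [n = 0] the slot list is empty: the field is its own coefficient, and multi-indices agreeing
   off [[::]] are equal. *)
all: apply: derivative_span_pure; exists [::], (fun mu x => T _ x mu).
all: split=> // [mu|mu nu E]; first exact: (OT _).1.
all: by rewrite (_ : mu = nu) //; apply/ffunP => k; exact: E.
Qed.

End DerivativeSpan.

Theorem lemma1 (R : realType) (D : nat) (hD : (1 <= D)%N)
    (Y : forall p : nat, young_diagram p)
    (num : forall p : nat, numbering (Y p))
    (c : nat -> R)
    (hc : forall p : nat, young_normalization D (num p) (c p))
    (N : nat) (hN : (2 <= N)%N)
    (hY : forall p : nat, (ncols (Y p) < N)%N)
    (T : graded_field R D) (hT : Omega_Y num c T) :
  forall (p : nat) (x : 'rV[R]_D), iter N (d num c) T p x = 0.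
Proof.
(* The exponent is now [N.+1]; in degree 0 the image of [d] is zero by definition. *)
case: N hN hY => // N _ hY [|p] x //=.
rewrite /d_homogeneous /young_symmetrizer.
(* Only the outermost [d] is opened: [N] derivatives from the iterate and one from [partial_field]
   fill [N.+1] slots, more than there are columns, just inside its column antisymmetrization. *)
rewrite (@col_antisymmetrize_derivative_span _ _ N.+1 _ _ _
  (fun y => row_symmetrize _ (partial_field _ y))) ?scaler0 //.
exact/derivative_span_row_symmetrize/derivative_span_partial/derivative_span_iter_d.
Qed.
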